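(* Let $k$ be a number field, $f\in k[t]$ a nonconstant polynomial, $E$ the elliptic curve over $k(t)$ given by $Y^2=X^3+f(t)$, and $(X_0(t),Y_0(t))\in E(k(t))$. For each $t\in k$ let $y_t=\sqrt{f(t)}$ (any choice of square root). Let $\mathfrak{p}$ be a prime of $\mathcal{O}_k$ not lying above $2$, and suppose there exists $t_{\mathfrak{p}}\in k$ with $f(t_{\mathfrak{p}})\neq 0$ and $3\mid\mathrm{ord}_{\mathfrak{p}}f(t_{\mathfrak{p}})$. Then there exists $\epsilon_{\mathfrak{p}}>0$ such that for every $t\in k$ with $|t-t_{\mathfrak{p}}|_{\mathfrak{p}}<\epsilon_{\mathfrak{p}}$ (and $t$ not a pole of $X_0,Y_0$, with $y_t\neq Y_0(t)$), and every prime $\mathfrak{q}$ of $k(y_t)$ lying above $\mathfrak{p}$, we have $3\mid\mathrm{ord}_{\mathfrak{q}}(y_t-Y_0(t))$.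
   Context: $\mathrm{ord}_{\mathfrak{p}}$ is the discrete valuation associated to the prime $\mathfrak{p}$ and $|\cdot|_{\mathfrak{p}}$ a corresponding $\mathfrak{p}$-adic absolute value. *)

(* Defs.v *)
(* Number fields are modelled as subfields of the algebraic
   complex numbers algC that are finite-dimensional over Q. *)
From HB Require Import structures.
From mathcomp Require Import all_boot all_order all_algebra all_field.
Set Implicit Arguments. Unset Strict Implicit. Unset Printing Implicit Defensive.
Import Order.TTheory GRing.Theory Num.Theory.
Local Open Scope ring_scope.

Definition is_subfield (F : algC -> Prop) : Prop :=
  F 0 /\ F 1 /\
  (forall x y, F x -> F y -> F (x + y)) /\
  (forall x, F x -> F (- x)) /\
  (forall x y, F x -> F y -> F (x * y)) /\
  (forall x, F x -> F (x^-1)).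

Definition number_field (F : algC -> Prop) : Prop :=
  is_subfield F /\
  exists (n : nat) (s : 'I_n -> algC),
    forall x, F x -> exists c : 'I_n -> rat, x = \sum_(i < n) ratr (c i) * s i.

Definition adjoin (F : algC -> Prop) (y : algC) : algC -> Prop :=
  fun z => forall G : algC -> Prop,
    is_subfield G -> (forall x, F x -> G x) -> G y -> G z.

Definition ringOI (F : algC -> Prop) (x : algC) : Prop := F x /\ x \in Aint.

Definition prime_of (F : algC -> Prop) (P : algC -> Prop) : Prop :=
  (forall x, P x -> ringOI F x) /\
  P 0 /\
  (forall x y, P x -> P y -> P (x + y)) /\
  (forall a x, ringOI F a -> P x -> P (a * x)) /\
  (exists x, P x /\ x != 0) /\
  ~ P 1 /\
  (forall x y, ringOI F x -> ringOI F y -> P (x * y) -> P x \/ P y).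

Fixpoint ipow (F : algC -> Prop) (P : algC -> Prop) (n : nat) (x : algC) : Prop :=
  match n with
  | 0 => ringOI F x
  | n'.+1 => exists s : seq (algC * algC),
      (forall ab, ab \in s -> P ab.1 /\ ipow F P n' ab.2) /\
      x = \sum_(ab <- s) ab.1 * ab.2
  end.

Definition ord_is (F : algC -> Prop) (P : algC -> Prop) (x : algC) (m : int) : Prop :=
  x != 0 /\
  exists (a b : algC) (na nb : nat),
    ringOI F a /\ ringOI F b /\ a != 0 /\ b != 0 /\ x = a / b /\
    (ipow F P na a /\ ~ ipow F P na.+1 a) /\
    (ipow F P nb b /\ ~ ipow F P nb.+1 b) /\
    m = (na%:Z - nb%:Z)%R.

Definition poly_over (F : algC -> Prop) (p : {poly algC}) : Prop :=
  forall i, F p`_i.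

(* Main.v *)
(* Put y = y_t and (X, Y) = (X_0(t), Y_0(t)). Then (y - Y)(y + Y) = -X^3 while (y - Y) + (y + Y) = 2y,
   and ord_q(2y) = ord_q(f(t))/2 is divisible by 3 because f(t) is p-adically close to f(t_p). If the
   two factors have different orders, the smaller one is ord_q(2y); if they agree, twice the order is
   a multiple of 3.

   The valuation is obtained without ideal factorization. Residue rings O/eO are finite, so by the
   pigeonhole principle every c in K whose powers have a common denominator is integral, and some c in
   K has cP inside O but not inside P. Then P^n = {x in O : c^n x in O}, and ord_P(x) = m exactly when
   c^m x is a unit of the localization of O at P. *)
Require Import Defs.
From HB Require Import structures.
From mathcomp Require Import all_boot all_order all_algebra all_field.
From mathcomp Require Import ring zify.
From Stdlib Require Import Classical.
Import Order.TTheory GRing.Theory Num.Theory.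
Local Open Scope ring_scope.

Set Implicit Arguments. Unset Strict Implicit. Unset Printing Implicit Defensive.

(** * Algebraic integers *)

Lemma Aint_integral (x : algC) : x \in Aint <-> integralOver (intr : int -> algC) x.
Proof.
split=> [/floorpP[p Dp] | [p mon_p px]].
  exists p; last by rewrite -Dp root_minCpoly.
  have := minCpoly_monic x; rewrite Dp !monicE lead_coef_map_inj ?rmorph0 //.
    by move=> /eqP lead1; apply/eqP/(intr_inj (R := algC)).
  exact: intr_inj.
apply: root_monic_Aint px _ _; first exact: monic_map.
by apply/polyOverP => i; rewrite coef_map /= intr_int.
Qed.

Lemma Aint_root_monic (p : {poly algC}) (x : algC) :
  root p x -> p \is monic -> p \is a polyOver Aint -> x \in Aint.
Proof.
move=> px mon_p /polyOverP pA; apply/Aint_integral/(integral_root_monic mon_p px).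
by move=> a /(nthP 0)[i _ <-]; apply/Aint_integral.
Qed.

Lemma Aint_of_expB (x : algC) (m n : nat) :
  (m < n)%N -> x ^+ n - x ^+ m \in Aint -> x \in Aint.
Proof.
move=> lt_mn xA; pose a := x ^+ n - x ^+ m.
apply: (@Aint_root_monic ('X^n - ('X^m + a%:P))).
- by rewrite rootE hornerD hornerN hornerD !hornerXn hornerC subrKC subrr.
- rewrite monicE lead_coefDl ?lead_coefXn // size_polyN size_polyXn ltnS.
  rewrite (leq_trans (size_polyD _ _)) // size_polyXn geq_max lt_mn.
  by rewrite (leq_trans (size_polyC_leq1 _)) // (leq_trans _ lt_mn).
by rewrite rpredB ?rpredD ?rpredX ?polyOverX ?polyOverC.
Qed.

(* If a clears the denominators of the minimal polynomial p of x, then the polynomial a^n p(X / a),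
   where n = deg p, is monic with integer coefficients and has the root a x. *)
Lemma Aint_natM_exists (x : algC) : exists2 n : nat, (0 < n)%N & n%:R * x \in Aint.
Proof.
have [p [Dp /monicP lead_p] _] := minCpolyP x; have := root_minCpoly x.
have [q [a a0 Dq]] := rat_poly_scale p; pose n := (size p).-1.
have size_p : size p = n.+1.
  by rewrite prednK // lt0n size_poly_eq0 -lead_coef_eq0 lead_p oner_eq0.
have coef_pM i : ratr p`_i * a%:~R = (q`_i)%:~R :> algC.
  by rewrite Dq coefZ coef_map rmorphM fmorphV /= !ratr_int mulrAC mulVf ?mul1r ?intr_eq0.
rewrite Dp => /rootP; rewrite horner_coef size_map_poly size_p => px.
have coef_lead : ratr p`_n = 1 :> algC by rewrite -/(lead_coef p) lead_p rmorph1.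
have: a%:~R * x \in Aint.
  apply: (@root_monic_Aint (\poly_(i < n.+1) (ratr p`_i * a%:~R ^+ (n - i)))).
  - apply/rootP; rewrite horner_poly -[RHS](mulr0 (a%:~R ^+ n)) -[in RHS]px mulr_sumr.
    apply: eq_bigr => -[i le_in] _; rewrite coef_map /=.
    by rewrite -[in RHS](subnK (m := i) le_in) exprD exprMn; ring.
  - by rewrite monicE lead_coef_poly //= subnn mulr1 coef_lead // oner_eq0.
  apply/polyOverP => i; rewrite coef_poly; case: ltnP => [le_in | _]; last by rewrite rpred0.
  have [->|ne_in] := eqVneq i n; first by rewrite coef_lead subnn mulr1 rpred1.
  have lt_in : (i < n)%N by rewrite ltn_neqAle ne_in.
  by rewrite -(subnSK lt_in) exprS mulrA coef_pM rpredM ?rpredX ?intr_int.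
rewrite {1}(intEsign a) rmorphM rmorph_sign -mulrA rpredMsign => ax.
by exists `|a|%N; rewrite ?absz_gt0 //= natr_absz.
Qed.

Lemma dvdAE (e x : algC) : e != 0 -> (e %| x)%A = (x / e \in Aint).
Proof. by rewrite unfold_in => /negPf->. Qed.

Lemma dvdA_mull (e a x : algC) : a \in Aint -> (e %| x)%A -> (e %| a * x)%A.
Proof. by move=> Aa; rewrite -!eqAmod0 => /(eqAmodMl Aa); rewrite mulr0. Qed.

Lemma dvdA_trans (e d x : algC) : (e %| d)%A -> (d %| x)%A -> (e %| x)%A.
Proof.
have [-> _ | d0 ed] := eqVneq d 0; first by rewrite unfold_in eqxx => /eqP->; apply: rpred0.
by rewrite dvdAE // => Axd; rewrite -(divfK d0 x); apply: dvdA_mull.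
Qed.

Lemma dvdA_mul2l (d e x : algC) : d != 0 -> (d * e %| d * x)%A = (e %| x)%A.
Proof.
move=> d0; rewrite ![(_ %| _)%A]unfold_in /= !mulf_eq0 (negPf d0) /=.
by rewrite -mulf_div divff // mul1r.
Qed.

(** * Subfields and their rings of integers *)

Section Subfield.

Variable K : algC -> Prop.
Hypothesis sK : is_subfield K.

Lemma subfield0 : K 0. Proof. by case: sK. Qed.

Lemma subfield1 : K 1. Proof. by case: sK => _ []. Qed.

Lemma subfieldD (x y : algC) : K x -> K y -> K (x + y).
Proof. by case: sK => _ [_ [KD _]]; apply: KD. Qed.

Lemma subfieldN (x : algC) : K x -> K (- x).
Proof. by case: sK => _ [_ [_ [KN _]]]; apply: KN. Qed.

Lemma subfieldB (x y : algC) : K x -> K y -> K (x - y).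
Proof. by move=> Kx Ky; apply/subfieldD/subfieldN. Qed.

Lemma subfieldM (x y : algC) : K x -> K y -> K (x * y).
Proof. by case: sK => _ [_ [_ [_ [KM _]]]]; apply: KM. Qed.

Lemma subfieldV (x : algC) : K x -> K x^-1.
Proof. by case: sK => _ [_ [_ [_ [_ KV]]]]; apply: KV. Qed.

Lemma subfield_div (x y : algC) : K x -> K y -> K (x / y).
Proof. by move=> Kx Ky; apply/subfieldM/subfieldV. Qed.

Lemma subfieldX (x : algC) (n : nat) : K x -> K (x ^+ n).
Proof.
move=> Kx; elim: n => [|n IHn]; first exact: subfield1.
by rewrite exprS; apply: subfieldM.
Qed.

Lemma subfield_nat (n : nat) : K n%:R.
Proof.
elim: n => [|n IHn]; first exact: subfield0.
by rewrite mulrS; apply: subfieldD => //; apply: subfield1.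
Qed.

Lemma subfield_int (n : int) : K n%:~R.
Proof.
case: n => n; first exact: subfield_nat.
by rewrite NegzE rmorphN; apply/subfieldN/subfield_nat.
Qed.

Lemma poly_over_horner (p : {poly algC}) (x : algC) :
  poly_over K p -> K x -> K p.[x].
Proof.
move=> Kp Kx; rewrite horner_coef; elim/big_ind: _ => [|y z|i _].
- exact: subfield0.
- exact: subfieldD.
by apply: subfieldM => //; apply: subfieldX.
Qed.

Local Notation O := (ringOI K).

Lemma ringOI1 : O 1. Proof. by split=> //; apply: subfield1. Qed.

Lemma ringOID (x y : algC) : O x -> O y -> O (x + y).
Proof. by move=> [Kx Ax] [Ky Ay]; split; [apply: subfieldD | rewrite rpredD]. Qed.

Lemma ringOIN (x : algC) : O x -> O (- x).
Proof. by move=> [Kx Ax]; split; [apply: subfieldN | rewrite rpredN]. Qed.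

Lemma ringOIB (x y : algC) : O x -> O y -> O (x - y).
Proof. by move=> Ox Oy; apply/ringOID/ringOIN. Qed.

Lemma ringOIM (x y : algC) : O x -> O y -> O (x * y).
Proof. by move=> [Kx Ax] [Ky Ay]; split; [apply: subfieldM | rewrite rpredM]. Qed.

Lemma ringOIX (x : algC) (n : nat) : O x -> O (x ^+ n).
Proof. by move=> [Kx Ax]; split; [apply: subfieldX | rewrite rpredX]. Qed.

Lemma ringOI_nat (n : nat) : O n%:R.
Proof. by split; [apply: subfield_nat | rewrite rpred_nat]. Qed.

Lemma ringOI_int (n : int) : O n%:~R.
Proof. by split; [apply: subfield_int | apply: Aint_int]. Qed.

Lemma ringOI_sum (I : Type) (r : seq I) (F : I -> algC) :
  (forall i, O (F i)) -> O (\sum_(i <- r) F i).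
Proof.
by move=> OF; elim/big_ind: _ => // [|x y]; [apply: (ringOI_nat 0) | apply: ringOID].
Qed.

Lemma ringOI_dvdA (e x : algC) : K e -> K x -> e != 0 -> (e %| x)%A -> O (x / e).
Proof. by move=> Ke Kx e0; rewrite dvdAE //; split=> //; apply: subfield_div. Qed.

Lemma subfield_frac (x : algC) : K x -> exists a b : algC, [/\ O a, O b, b != 0 & x = a / b].
Proof.
move=> Kx; have [n n0 Anx] := Aint_natM_exists x.
have nC : n%:R != 0 :> algC by rewrite pnatr_eq0 -lt0n.
exists (n%:R * x), n%:R; split=> //; last by rewrite mulrC mulKf.
  by split=> //; apply: subfieldM => //; apply: subfield_nat.
exact: ringOI_nat.
Qed.

End Subfield.

(** * Finiteness of residue rings *)

Lemma rat_span_dependent (F : numFieldType) (m n : nat) (s : 'I_n -> F) (e : 'I_m -> F) :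
  (n < m)%N ->
  (forall i, exists c : 'I_n -> rat, e i = \sum_(j < n) ratr (c j) * s j) ->
  exists2 w : 'rV[rat]_m, w != 0 & \sum_(i < m) ratr (w 0 i) * e i = 0.
Proof.
move=> lt_nm /fin_all_exists[C De].
pose A : 'M[rat]_(m, n) := \matrix_(i, j) C i j.
have : kermx A != 0.
  by rewrite -mxrank_eq0 mxrank_ker -lt0n subn_gt0 (leq_ltn_trans (rank_leq_col _)).
case/rowV0Pn=> w /sub_kermxP wA w0; exists w => //.
transitivity (\sum_(j < n) ratr ((w *m A) 0 j) * s j); last first.
  by rewrite wA big1 // => j _; rewrite mxE rmorph0 mul0r.
under [RHS]eq_bigr => j _ do rewrite mxE rmorph_sum mulr_suml.
rewrite exchange_big; apply: eq_bigr => i _; rewrite De mulr_sumr.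
by apply: eq_bigr => j _; rewrite mxE rmorphM mulrA.
Qed.

Lemma rat_row_primitive (m : nat) (w : 'rV[rat]_m) : w != 0 ->
  exists (a : rat) (v : 'I_m -> int), [/\ a != 0, forall i, w 0 i = a * (v i)%:~R &
    forall d : int, (forall i, (d %| v i)%Z) -> (d %| 1)%Z].
Proof.
move=> w0; have [q [a a0 Dq]] := rat_poly_scale (rVpoly w).
have q0 : q != 0.
  apply: contraNneq w0 => q0; apply/eqP/(can_inj rVpolyK).
  by rewrite Dq q0 rmorph0 scaler0 linear0.
pose b : rat := a%:~R^-1 * (zcontents q)%:~R.
have b0 : b != 0 by rewrite mulf_neq0 ?invr_eq0 ?intr_eq0 ?zcontents_eq0.
have Dw i : (rVpoly w)`_i = b * ((zprimitive q)`_i)%:~R.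
  by rewrite Dq coefZ coef_map /= {1}[q]zpolyEprim coefZ intrM mulrA.
exists b, (fun i => (zprimitive q)`_i); split=> // [i | d dv].
  by rewrite -coef_rVpoly_ord.
suff: (d %| zcontents (zprimitive q))%Z by rewrite zcontents_primitive q0.
rewrite dvdz_contents; apply/polyOverP => i.
have [lt_im | le_mi] := ltnP i m; first exact: (dv (Ordinal lt_im)).
suff /eqP-> : (zprimitive q)`_i == 0 by apply: dvdz0.
have /eqP := Dw i; rewrite coef_rVpoly insubF ?ltnNge ?le_mi // eq_sym mulf_eq0.
by rewrite (negPf b0) intr_eq0.
Qed.

Definition int_comb (R : pzRingType) (e : seq R) (c : 'I_(size e) -> int) : R :=
  \sum_(i < size e) (c i)%:~R * e`_i.

Lemma int_comb_cons (R : pzRingType) (x : R) (e : seq R) (c : 'I_(size (x :: e)) -> int) :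
  int_comb c = (c ord0)%:~R * x + int_comb (e := e) (c \o lift ord0).
Proof. by rewrite /int_comb big_ord_recl. Qed.

Lemma int_combZ (R : pzRingType) (e : seq R) (a : int) (c : 'I_(size e) -> int) :
  int_comb (fun i => a * c i) = a%:~R * int_comb c.
Proof. by rewrite mulr_sumr; apply: eq_bigr => i _; rewrite intrM mulrA. Qed.

Lemma ringOI_int_comb (K : algC -> Prop) (e : seq algC) (c : 'I_(size e) -> int) :
  is_subfield K -> {in e, forall x, ringOI K x} -> ringOI K (int_comb c).
Proof.
move=> sK Oe; apply: ringOI_sum => // i.
by apply: ringOIM => //; [apply: ringOI_int | apply/Oe/mem_nth].
Qed.

Definition indep_mod (p : nat) (e : seq algC) : Prop :=
  forall c : 'I_(size e) -> int,
    (p%:R %| int_comb c)%A -> forall i, (p%:Z %| c i)%Z.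

Lemma indep_mod_cons (p : nat) (x : algC) (e : seq algC) :
  prime p -> {in x :: e, forall y, y \in Aint} -> indep_mod p e ->
  (forall c : 'I_(size e) -> int, ~~ (x == int_comb c %[mod p%:R])%A) ->
  indep_mod p (x :: e).
Proof.
move=> pr_p Axe indep_e notin_x c; rewrite int_comb_cons; set c' := _ \o _ => dvd_comb.
have Ax : x \in Aint by apply: Axe; apply: mem_head.
have pAM y : y \in Aint -> (p%:R %| y * p%:R)%A.
  by move=> Ay; rewrite -eqAmod0 eqAmodMl0.
have dvd_c0 : (p%:Z %| c ord0)%Z.
  apply/idPn => ndvd_c0.
  have cop : coprimez (c ord0) p by rewrite coprimez_sym coprimezE prime_coprime.
  have [[u w] /= Duw] := coprimezP _ _ cop.
  have Dx : x = u%:~R * ((c ord0)%:~R * x) + w%:~R * x * p%:R.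
    have bezout : u%:~R * (c ord0)%:~R + w%:~R * p%:R = 1 :> algC.
      by rewrite pmulrn -!intrM -rmorphD Duw.
    by rewrite -[LHS]mul1r -[X in X * _ = _]bezout; ring.
  case/negP: (notin_x (fun i => - u * c' i)); rewrite int_combZ rmorphN mulNr /eqAmod opprK.
  rewrite [X in X + _]Dx addrAC -mulrDr rpredD ?pAM ?rpredM ?Aint_int //.
  exact: dvdA_mull (Aint_int _) dvd_comb.
move=> i; have [j ->|-> //] := unliftP ord0 i.
apply: (indep_e c'); have [q Dq] := dvdzP dvd_c0.
rewrite -(addKr ((c ord0)%:~R * x) (int_comb c')) rpredD // rpredN Dq intrM mulrAC.
by rewrite pAM ?rpredM ?Aint_int.
Qed.

Lemma indep_mod_size (K : algC -> Prop) (n : nat) (s : 'I_n -> algC) (p : nat) (e : seq algC) :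
  (forall x, K x -> exists c : 'I_n -> rat, x = \sum_(i < n) ratr (c i) * s i) ->
  prime p -> {in e, forall x, K x} -> indep_mod p e -> (size e <= n)%N.
Proof.
move=> spanK pr_p Ke indep_e; rewrite leqNgt; apply/negP => lt_n.
have [i|w w0 dep] := @rat_span_dependent _ _ _ s (fun i : 'I_(size e) => e`_i) lt_n.
  exact/spanK/Ke/mem_nth.
have [a [v [a0 Dw prim_v]]] := rat_row_primitive w0.
have comb0 : int_comb v = 0.
  apply: (mulfI (x := ratr a)); first by rewrite fmorph_eq0.
  rewrite mulr0 -[RHS]dep mulr_sumr; apply: eq_bigr => i _.
  by rewrite Dw rmorphM /= ratr_int mulrA.
have: (p%:Z %| 1)%Z by apply/prim_v/indep_e; rewrite comb0 rpred0.
by rewrite dvdzE dvdn1 absz_nat => /eqP p1; rewrite p1 in pr_p.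
Qed.

Definition residue_reps (K : algC -> Prop) (e : algC) (L : seq algC) : Prop :=
  {in L, forall r, ringOI K r} /\
  forall x, ringOI K x -> exists2 r, r \in L & (x == r %[mod e])%A.

Section FiniteResidues.

Variable K : algC -> Prop.
Hypothesis nfK : number_field K.
Local Notation O := (ringOI K).

Let sK : is_subfield K := proj1 nfK.

(* A maximal family of integers independent modulo p generates O modulo p. *)
Lemma generators_mod_prime (p : nat) : prime p ->
  exists2 e : seq algC, {in e, forall x, O x} &
    forall x, O x -> exists c : 'I_(size e) -> int, (x == int_comb c %[mod p%:R])%A.
Proof.
move=> pr_p; apply: NNPP => no_gen; have [n [s spanK]] := proj2 nfK.
have [e [size_e Oe indep_e]] : exists e, [/\ size e = n.+1, {in e, forall x, O x} & indep_mod p e].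
  elim: {s spanK} n.+1 => [|m [e [size_e Oe indep_e]]].
    by exists [::]; split=> // c _ [].
  apply: NNPP => no_ext; apply: no_gen; exists e => // x Ox; apply: NNPP => no_comb.
  have Oxe : {in x :: e, forall y, O y} by move=> y; rewrite inE => /predU1P[-> //|/Oe].
  apply: no_ext; exists (x :: e); split=> //=; first by rewrite size_e.
  apply: indep_mod_cons => // [y /Oxe[] // | c].
  by apply/negP => comb_x; apply: no_comb; exists c.
suff: (n.+1 <= n)%N by rewrite ltnn.
by rewrite -{1}size_e; apply: indep_mod_size spanK pr_p _ indep_e => x /Oe[].
Qed.

Lemma residue_reps_prime (p : nat) : prime p -> exists L, residue_reps K p%:R L.
Proof.
move=> pr_p; have [e Oe gen_e] := generators_mod_prime pr_p.
exists [seq int_comb (fun i => (d i : nat)%:Z) | d : {ffun 'I_(size e) -> 'I_p}].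
split=> [_ /imageP[d _ ->] | x /gen_e[c x_c]]; first exact: ringOI_int_comb.
have lt_mod (z : int) : (`|(z %% p)%Z| < p)%N.
  by rewrite -ltz_nat gez0_abs ?modz_ge0 ?ltz_pmod ?ltz_nat // -?lt0n prime_gt0.
pose d := [ffun i => Ordinal (lt_mod (c i))].
exists (int_comb (fun i => (d i : nat)%:Z)); first by apply/imageP; exists d.
apply: eqAmod_trans x_c _; rewrite /eqAmod -sumrB rpred_sum // => i _.
rewrite -mulrBl -rmorphB ffunE /= gez0_abs ?modz_ge0 -?lt0n ?prime_gt0 //.
rewrite {1}(divz_eq (c i) p) addrK intrM mulrAC -eqAmod0 eqAmodMl0 //.
by rewrite rpredM ?Aint_int //; case: (Oe e`_i) => //; apply: mem_nth.
Qed.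

Lemma residue_repsM (d e : algC) (L M : seq algC) : O d -> d != 0 ->
  residue_reps K d L -> residue_reps K e M ->
  residue_reps K (d * e) [seq r + d * s | r <- L, s <- M].
Proof.
move=> Od d0 [OL repL] [OM repM]; split=> [_ /allpairsP[[r s] [/= rL sM ->]] | x Ox].
  by apply: ringOID (OL _ rL) (ringOIM _ _ (OM _ sM)).
have [r rL x_r] := repL x Ox.
have Oxr : O ((x - r) / d).
  case: (OL r rL) Od Ox => Kr _ [Kd _] [Kx _].
  by apply: ringOI_dvdA => //; apply: subfieldB.
have [s sM x_s] := repM _ Oxr; exists (r + d * s); first exact: allpairs_f.
by rewrite /eqAmod opprD addrA -(divfK d0 (x - r)) [_ / d * d]mulrC -mulrBr dvdA_mul2l.
Qed.

Lemma residue_reps_nat (n : nat) : (0 < n)%N -> exists L, residue_reps K n%:R L.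
Proof.
elim/ltn_ind: n => n IHn n0; have [n1|n1] := leqP n 1.
  exists [:: 0]; split=> [r /[!inE]/eqP-> | x [_ Ax]]; first exact: (ringOI_nat sK 0).
  have -> : n = 1%N by apply/eqP; rewrite eqn_leq n1.
  by exists 0; rewrite ?inE // eqAmod0 dvdAE ?oner_eq0 // divr1.
have pr_p := pdiv_prime n1; set p := pdiv n in pr_p.
have [L repL] := residue_reps_prime pr_p.
have [||M repM] := IHn (n %/ p)%N.
- by rewrite ltn_Pdiv // prime_gt1.
- by rewrite divn_gt0 ?prime_gt0 // dvdn_leq // pdiv_dvd.
have -> : n%:R = p%:R * (n %/ p)%:R :> algC by rewrite -natrM mulnC divnK // pdiv_dvd.
eexists; apply: residue_repsM repL repM; try exact: ringOI_nat.
by rewrite pnatr_eq0 -lt0n prime_gt0.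
Qed.

Lemma residue_reps_exist (e : algC) : e != 0 -> exists L, residue_reps K e L.
Proof.
move=> e0; have [n n0 Ane] := Aint_natM_exists e^-1.
have e_n : (e %| n%:R)%A by rewrite dvdAE.
have [L [OL repL]] := residue_reps_nat n0; exists L; split=> // x Ox.
by have [r rL x_r] := repL x Ox; exists r => //; apply: dvdA_trans x_r.
Qed.

Lemma ringOI_pigeonhole (e : algC) (s : nat -> algC) : e != 0 -> (forall i, O (s i)) ->
  exists i j : nat, (i < j)%N /\ (s j == s i %[mod e])%A.
Proof.
move=> e0 Os; have [L [_ repL]] := residue_reps_exist e0.
have /fin_all_exists2[g gL s_g] (i : 'I_(size L).+1) :
  exists2 r, r \in L & (s i == r %[mod e])%A by apply: repL.
have /injectivePn[i [j ij gij]] : ~~ injectiveb g.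
  apply/negP => /injectiveP g_inj.
  have: (size (codom g) <= size L)%N.
    by apply: uniq_leq_size => [|_ /codomP[i ->] //]; apply/injectiveP.
  by rewrite size_codom card_ord ltnn.
have s_ij : (s j == s i %[mod e])%A.
  by apply: eqAmod_trans (s_g j) _; rewrite eqAmod_sym -gij s_g.
have [lt_ij | lt_ji | eq_ij] := ltngtP i j; first by exists i, j.
  by exists j, i; rewrite eqAmod_sym.
by case/eqP: ij; apply: val_inj.
Qed.

Lemma dvdA_exp_1Bexp_exists (e u : algC) : e != 0 -> O u ->
  exists i k : nat, (e %| u ^+ i * (1 - u ^+ k.+1))%A.
Proof.
move=> e0 Ou; have [i [j [lt_ij eq_ij]]] := ringOI_pigeonhole e0 (fun i => ringOIX sK i Ou).
exists i, (j - i).-1; rewrite prednK ?subn_gt0 // mulrBr mulr1 -exprD subnKC 1?ltnW //.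
by rewrite -/(eqAmod _ _ _) eqAmod_sym.
Qed.

Lemma almost_integral (c x : algC) :
  K c -> x != 0 -> (forall n, O (c ^+ n * x)) -> O c.
Proof.
move=> Kc x0 Ocx; have [i [j [lt_ij]]] := ringOI_pigeonhole x0 Ocx.
rewrite /eqAmod -mulrBl dvdAE // mulfK // => Acij.
by split=> //; apply: Aint_of_expB lt_ij Acij.
Qed.

End FiniteResidues.

(** * Prime ideals *)

(* The image of b in the localization of O/eO at P is nonzero. *)
Definition local_nonzero (K P : algC -> Prop) (e b : algC) : Prop :=
  forall s, ringOI K s -> ~ P s -> ~~ (e %| s * b)%A.

(* In terms of the orders at primes: ord_P c = -1, and ord_q c >= 0 for all q other than P. *)
Definition inverse_uniformizer (K P : algC -> Prop) (c pi : algC) : Prop :=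
  [/\ K c, forall x, P x -> ringOI K (c * x), P pi & ~ P (c * pi)].

Section PrimeIdeal.

Variables K P : algC -> Prop.
Hypothesis nfK : number_field K.
Hypothesis prP : prime_of K P.
Local Notation O := (ringOI K).

Let sK : is_subfield K := proj1 nfK.

Lemma prime_sub (x : algC) : P x -> O x.
Proof. by case: prP => PO _; apply: PO. Qed.

Lemma prime0 : P 0.
Proof. by case: prP => _ []. Qed.

Lemma primeD (x y : algC) : P x -> P y -> P (x + y).
Proof. by case: prP => _ [_ [PD _]]; apply: PD. Qed.

Lemma primeMl (a x : algC) : O a -> P x -> P (a * x).
Proof. by case: prP => _ [_ [_ [PM _]]]; apply: PM. Qed.

Lemma prime_neq0_exists : exists2 x, P x & x != 0.
Proof. by case: prP => _ [_ [_ [_ [[x []]]]]]; exists x. Qed.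

Lemma nprime1 : ~ P 1.
Proof. by case: prP => _ [_ [_ [_ [_ []]]]]. Qed.

Lemma nprimeM (x y : algC) : O x -> O y -> ~ P x -> ~ P y -> ~ P (x * y).
Proof. by case: prP => _ [_ [_ [_ [_ [_ prM]]]]] Ox Oy nPx nPy /prM[]. Qed.

Lemma nprimeX (x : algC) (n : nat) : O x -> ~ P x -> ~ P (x ^+ n).
Proof.
move=> Ox nPx; elim: n => [|n IHn]; first exact: nprime1.
by rewrite exprS; apply: nprimeM => //; apply: ringOIX.
Qed.

Lemma nprime_neq0 (x : algC) : ~ P x -> x != 0.
Proof. by apply: contra_notN => /eqP->; apply: prime0. Qed.

Lemma nprime_1Bexp (x : algC) (n : nat) : P x -> ~ P (1 - x ^+ n.+1).
Proof.
move=> Px P1x; apply: nprime1; rewrite -(subrK (x ^+ n.+1) 1); apply: primeD => //.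
by rewrite exprSr; apply: primeMl => //; apply/ringOIX/prime_sub.
Qed.

Lemma prime_dvdA (e x : algC) : P e -> O x -> (e %| x)%A -> P x.
Proof.
have [-> _ _ | e0 Pe [Kx _] ex] := eqVneq e 0.
  by rewrite unfold_in eqxx => /eqP->; apply: prime0.
rewrite -(divfK e0 x); apply: primeMl => //.
by apply: ringOI_dvdA => //; case: (prime_sub Pe).
Qed.

Lemma prime_maximal (u : algC) : O u -> ~ P u -> exists2 w, O w & P (1 - w * u).
Proof.
move=> Ou nPu; have [e Pe e0] := prime_neq0_exists.
have [i [k dvd_e]] := dvdA_exp_1Bexp_exists nfK e0 Ou.
have O1u : O (1 - u ^+ k.+1) by apply: ringOIB; [|apply: ringOI1|apply: ringOIX].
exists (u ^+ k); first exact: ringOIX.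
rewrite -exprSr; apply: NNPP => nP1u.
have Oui := ringOIX sK i Ou.
apply: (nprimeM Oui O1u (nprimeX (n := i) Ou nPu) nP1u).
by apply: prime_dvdA dvd_e => //; apply: ringOIM.
Qed.

Lemma not_local_nonzero_expM (e b x : algC) : e != 0 -> O b -> P x ->
  exists i : nat, ~ local_nonzero K P e (b * x ^+ i).
Proof.
move=> e0 [_ Ab] Px; have Ox := prime_sub Px.
have [i [k dvd_e]] := dvdA_exp_1Bexp_exists nfK e0 Ox; exists i.
have O1x : O (1 - x ^+ k.+1) by apply: ringOIB; [|apply: ringOI1|apply: ringOIX].
move/(_ _ O1x (nprime_1Bexp (n := k) Px))/negP; apply.
have -> : (1 - x ^+ k.+1) * (b * x ^+ i) = b * (x ^+ i * (1 - x ^+ k.+1)) by ring.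
exact: dvdA_mull.
Qed.

(* Powers of x eventually kill b in the localization: multiply b by the last power that does not. *)
Lemma local_nonzero_kill (e b x : algC) :
  e != 0 -> O b -> local_nonzero K P e b -> P x ->
  exists a, [/\ O a, local_nonzero K P e (a * b) & (e %| a * b * x)%A].
Proof.
move=> e0 Ob nz_b Px; have Ox := prime_sub Px.
have [k [nz_k z_k]] : exists k, local_nonzero K P e (b * x ^+ k) /\
    ~ local_nonzero K P e (b * x ^+ k.+1).
  have [i] := not_local_nonzero_expM e0 Ob Px.
  elim: i => [|i IHi] z_i; first by rewrite mulr1 in z_i.
  by have [nz_i|/IHi//] := classic (local_nonzero K P e (b * x ^+ i)); exists i.
have [s [Os nPs dvd_s]] : exists s, [/\ O s, ~ P s & (e %| s * (b * x ^+ k.+1))%A].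
  apply: NNPP => none; apply: z_k => s Os nPs; apply/negP => dvd_s.
  by apply: none; exists s.
exists (s * x ^+ k); split.
- by apply: ringOIM => //; apply: ringOIX.
- move=> t Ot nPt; have -> : t * (s * x ^+ k * b) = t * s * (b * x ^+ k) by ring.
  by apply: nz_k; [apply: ringOIM | apply: nprimeM].
by have <- : s * (b * x ^+ k.+1) = s * x ^+ k * b * x by rewrite exprSr; ring.
Qed.

Lemma local_nonzero_kill_seq (e : algC) (L : seq algC) : P e -> e != 0 ->
  exists b, [/\ O b, local_nonzero K P e b & {in L, forall r, P r -> (e %| b * r)%A}].
Proof.
move=> Pe e0; elim: L => [|x L [b [Ob nz_b bL]]].
  exists 1; split=> // [|s Os nPs]; first exact: ringOI1.
  by rewrite mulr1; apply/negP => /(prime_dvdA Pe Os).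
have [Px | nPx] := classic (P x); last first.
  by exists b; split=> // r; rewrite inE => /predU1P[-> // | rL]; apply: bL.
have [a [Oa nz_ab dvd_abx]] := local_nonzero_kill e0 Ob nz_b Px.
exists (a * b); split=> // [|r]; first exact: ringOIM.
rewrite inE => /predU1P[-> // | rL Pr]; rewrite -mulrA dvdA_mull ?bL //.
by case: Oa.
Qed.

Lemma prime_annihilator (e : algC) : P e -> e != 0 ->
  exists b, [/\ O b, ~~ (e %| b)%A & forall x, P x -> (e %| b * x)%A].
Proof.
move=> Pe e0; have [L [OL repL]] := residue_reps_exist nfK e0.
have [b [Ob nz_b bL]] := local_nonzero_kill_seq L Pe e0.
exists b; split=> // [|x Px].
  by rewrite -[b]mul1r nz_b //; [apply: ringOI1 | apply: nprime1].
have [r rL x_r] := repL x (prime_sub Px).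
have Pr : P r.
  rewrite -(subKr x r) -mulN1r; apply: primeD => //; apply: primeMl.
    exact/ringOIN/ringOI1.
  by apply: prime_dvdA x_r => //; apply: ringOIB => //; [apply: prime_sub | apply: OL].
rewrite -(subrK r x) mulrDr rpredD //; last exact: bL.
by apply: dvdA_mull x_r; case: Ob.
Qed.

(* If c = b / e mapped P to itself, all c^i e would lie in O, so c would be integral
   and e would divide b. *)
Lemma inverse_uniformizer_exists : exists c pi, inverse_uniformizer K P c pi.
Proof.
have [e Pe e0] := prime_neq0_exists; have [b [[Kb _] ndvd_b bP]] := prime_annihilator Pe e0.
have Ke : K e by case: (prime_sub Pe).
have Kc : K (b / e) by apply: subfield_div.
have cP x : P x -> O (b / e * x).
  move=> Px; rewrite mulrAC; apply: ringOI_dvdA => //; last exact: bP.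
  by apply: subfieldM => //; case: (prime_sub Px).
apply: NNPP => none; case/negP: ndvd_b; rewrite dvdAE //.
suff [] : O (b / e) by [].
apply: (almost_integral nfK Kc e0) => i; apply: prime_sub.
elim: i => [|i Pi]; first by rewrite mul1r.
apply: NNPP => nPi; apply: none; exists (b / e), ((b / e) ^+ i * e).
by split=> //; rewrite mulrA -exprS.
Qed.

End PrimeIdeal.

(** * Valuations *)

Definition local_int (K P : algC -> Prop) (x : algC) : Prop :=
  exists a b : algC, [/\ ringOI K a, ringOI K b, ~ P b & x = a / b].

Definition local_unit (K P : algC -> Prop) (x : algC) : Prop :=
  exists a b : algC, [/\ ringOI K a, ringOI K b, ~ P a, ~ P b & x = a / b].

(* The order of 0, at which ord_is fails, counts as infinite here and in ord_dvd. *)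
Definition ord_ge (K P : algC -> Prop) (x : algC) (n : int) : Prop :=
  x = 0 \/ exists m : int, ord_is K P x m /\ n <= m.

Section LocalRing.

Variables K P : algC -> Prop.
Hypothesis nfK : number_field K.
Hypothesis prP : prime_of K P.
Local Notation O := (ringOI K).
Local Notation loc := (local_int K P).
Local Notation locu := (local_unit K P).

Let sK : is_subfield K := proj1 nfK.
Let nP_neq0 := nprime_neq0 prP.

Lemma local_int_ringOI (x : algC) : O x -> loc x.
Proof.
move=> Ox; exists x, 1; rewrite divr1; split=> //; first exact: ringOI1.
exact: nprime1 prP.
Qed.

Lemma local_intD (x y : algC) : loc x -> loc y -> loc (x + y).
Proof.
move=> [a [b [Oa Ob nPb ->]]] [a' [b' [Oa' Ob' nPb' ->]]].
exists (a * b' + a' * b), (b * b'); split.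
- by apply: ringOID => //; apply: ringOIM.
- exact: ringOIM.
- exact: (nprimeM prP).
by rewrite addf_div ?nP_neq0.
Qed.

Lemma local_intM (x y : algC) : loc x -> loc y -> loc (x * y).
Proof.
move=> [a [b [Oa Ob nPb ->]]] [a' [b' [Oa' Ob' nPb' ->]]].
exists (a * a'), (b * b'); split; [exact: ringOIM | exact: ringOIM | |].
  exact: (nprimeM prP).
by rewrite mulf_div.
Qed.

Lemma local_intX (x : algC) (n : nat) : loc x -> loc (x ^+ n).
Proof.
move=> lx; elim: n => [|n IHn]; last by rewrite exprS; apply: local_intM.
exact/local_int_ringOI/ringOI1.
Qed.

Lemma local_unit_int (x : algC) : locu x -> loc x.
Proof. by move=> [a [b [Oa Ob _ nPb ->]]]; exists a, b. Qed.

Lemma local_unit_nprime (x : algC) : O x -> ~ P x -> locu x.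
Proof.
move=> Ox nPx; exists x, 1; rewrite divr1; split=> //; first exact: ringOI1.
exact: nprime1 prP.
Qed.

Lemma local_unitM (x y : algC) : locu x -> locu y -> locu (x * y).
Proof.
move=> [a [b [Oa Ob nPa nPb ->]]] [a' [b' [Oa' Ob' nPa' nPb' ->]]].
exists (a * a'), (b * b'); split; try exact: ringOIM; try exact: (nprimeM prP).
by rewrite mulf_div.
Qed.

Lemma local_unitV (x : algC) : locu x -> locu x^-1.
Proof. by move=> [a [b [Oa Ob nPa nPb ->]]]; exists b, a; rewrite invf_div. Qed.

End LocalRing.

Section InverseUniformizer.

Variables K P : algC -> Prop.
Hypothesis nfK : number_field K.
Hypothesis prP : prime_of K P.
Local Notation O := (ringOI K).
Local Notation loc := (local_int K P).
Local Notation locu := (local_unit K P).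

Let sK : is_subfield K := proj1 nfK.

Variables c pi : algC.
Hypothesis unif : inverse_uniformizer K P c pi.

Let cP (x : algC) : P x -> O (c * x). Proof. by case: unif => _ + _ _; apply. Qed.
Let Ppi : P pi. Proof. by case: unif. Qed.
Let nPcpi : ~ P (c * pi). Proof. by case: unif. Qed.
Let Ocpi : O (c * pi) := cP Ppi.
Let Opi : O pi := prime_sub prP Ppi.

Let c_pi_neq0 : (c != 0) && (pi != 0).
Proof. by rewrite -negb_or -mulf_eq0 (nprime_neq0 prP nPcpi). Qed.

Lemma inv_unif_neq0 : c != 0.
Proof. by case/andP: c_pi_neq0. Qed.

Lemma prime_of_expM (x : algC) (n : nat) : O x -> O (c ^+ n.+1 * x) -> P x.
Proof.
move=> Ox Ocx; apply: NNPP => nPx.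
have nPcpiX : ~ P ((c * pi) ^+ n.+1) by apply: (nprimeX nfK prP).
apply: (nprimeM prP (ringOIX sK n.+1 Ocpi) Ox nPcpiX nPx).
have -> : (c * pi) ^+ n.+1 * x = (pi ^+ n * (c ^+ n.+1 * x)) * pi.
  by rewrite exprMn (exprSr pi); ring.
by apply: (primeMl prP) => //; apply: ringOIM => //; apply: ringOIX.
Qed.

Lemma ringOI_expM_pred (x : algC) (n : nat) : O x -> O (c ^+ n.+1 * x) -> O (c ^+ n * x).
Proof.
move=> Ox Ocx; suff: forall j, (j <= n)%N -> O (c ^+ j * x) by apply.
elim=> [|j IHj] lt_jn; first by rewrite mul1r.
rewrite exprS -mulrA; apply: cP; apply: (@prime_of_expM _ (n - j)).
  exact/IHj/ltnW.
by rewrite mulrA -exprD addSn subnK // ltnW.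
Qed.

Lemma ipow_expM (n : nat) (x : algC) : ipow K P n x -> O x /\ O (c ^+ n * x).
Proof.
elim: n x => [|n IHn] x /=; first by rewrite mul1r.
case=> s [sP ->]; rewrite big_seq.
elim/big_ind: _ => [|y z [Oy Ocy] [Oz Ocz]|ab /sP[Pa /IHn[Ob Ocb]]].
- by rewrite mulr0; split; apply: (ringOI_nat sK 0).
- by rewrite mulrDr; split; apply: ringOID.
split; first by apply: ringOIM => //; apply: (prime_sub prP).
have -> : c ^+ n.+1 * (ab.1 * ab.2) = c * ab.1 * (c ^+ n * ab.2) by rewrite exprS; ring.
by apply: ringOIM => //; apply: cP.
Qed.

(* With w c pi + z = 1 and z in P, an element x is pi (w c x) + z x. *)
Lemma expM_ipow (n : nat) (x : algC) : O x -> O (c ^+ n * x) -> ipow K P n x.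
Proof.
elim: n x => [|n IHn] x //= Ox Ocx; have Px := prime_of_expM Ox Ocx.
have [w Ow Pz] := prime_maximal nfK prP Ocpi nPcpi; set z := 1 - _ in Pz.
exists [:: (pi, w * (c * x)); (z, x)]; split; last by rewrite big_cons big_seq1 /= /z; ring.
move=> ab /[!inE] /pred2P[] -> /=; split=> //; apply: IHn => //.
- by apply: ringOIM => //; apply: cP.
- have -> : c ^+ n * (w * (c * x)) = w * (c ^+ n.+1 * x) by rewrite exprSr; ring.
  exact: ringOIM.
exact: ringOI_expM_pred.
Qed.

Lemma ipow_exactP (n : nat) (x : algC) :
  (ipow K P n x /\ ~ ipow K P n.+1 x) <-> [/\ O x, O (c ^+ n * x) & ~ P (c ^+ n * x)].
Proof.
split=> [[/ipow_expM[Ox Ocx] nxS] | [Ox Ocx nPcx]]; split=> //.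
- by move=> Pcx; apply/nxS/expM_ipow => //; rewrite exprS -mulrA; apply: cP.
- exact: expM_ipow.
move=> /ipow_expM[_ OcSx]; apply: nPcx; apply: (@prime_of_expM _ 0) => //.
by rewrite expr1 mulrA -exprS.
Qed.

Lemma ipow_exact_exists (x : algC) : O x -> x != 0 ->
  exists n : nat, O (c ^+ n * x) /\ ~ P (c ^+ n * x).
Proof.
move=> Ox x0; have Kc : K c by case: unif.
have [n nOn] : exists n, ~ O (c ^+ n * x).
  apply: not_all_ex_not => Ocx; apply: nPcpi; apply: (primeMl prP) => //.
  exact: almost_integral Ocx.
elim: n nOn => [|n IHn] nOn; first by rewrite mul1r in nOn.
have [On | /IHn//] := classic (O (c ^+ n * x)).
by exists n; split=> // Pn; apply: nOn; rewrite exprS -mulrA; apply: cP.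
Qed.

Lemma local_unit_expz_inv_unif (n : int) : locu (c ^ n) -> n = 0.
Proof.
wlog [k ->] : n / exists k : nat, n = k%:Z => [nat_case|].
  case: n => k ux; first by apply: nat_case => //; exists k.
  suff: k.+1%:Z = 0 by [].
  by apply: nat_case; [exists k.+1 | rewrite -[c ^ _]invrK; apply: local_unitV].
case: k => // k [a [b [Oa Ob _ nPb Dab]]]; have b0 := nprime_neq0 prP nPb.
case: nPb; apply: (@prime_of_expM _ k) => //.
by rewrite -[c ^+ _]/(c ^ k.+1%:Z) Dab divfK.
Qed.

Lemma nprime_cpi_expM (n : nat) (u : algC) :
  O u -> ~ P u -> O ((c * pi) ^+ n * u) /\ ~ P ((c * pi) ^+ n * u).
Proof.
move=> Ou nPu; split; first by apply: ringOIM => //; apply: ringOIX.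
by apply: (nprimeM prP) => //; [apply: ringOIX | apply: (nprimeX nfK prP)].
Qed.

Lemma ipow_exact_pi_expM (n : nat) (u : algC) : O u -> ~ P u ->
  ipow K P n (pi ^+ n * u) /\ ~ ipow K P n.+1 (pi ^+ n * u).
Proof.
move=> Ou nPu; have [Ocpiu nPcpiu] := nprime_cpi_expM n Ou nPu.
by apply/ipow_exactP; rewrite mulrA -exprMn; split=> //; apply: ringOIM => //; apply: ringOIX.
Qed.

Lemma ord_isP (x : algC) (m : int) : ord_is K P x m <-> locu (c ^ m * x).
Proof.
have [c0 pi0] := andP c_pi_neq0.
split=> [[_ [a [b [na [nb]]]]] | [a [b [Oa Ob nPa nPb Dx]]]].
  move=> [_ [_ [_ [_ [-> [/ipow_exactP[_ Oca nPca] [/ipow_exactP[_ Ocb nPcb] ->]]]]]]].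
  exists (c ^+ na * a), (c ^+ nb * b); split=> //.
  by rewrite expfzDr // -invr_expz -!exprnP mulf_div.
have [na [nb Dm]] : exists na nb : nat, m = na%:Z - nb%:Z.
  by case: m {Dx} => n; [exists n, 0%N; rewrite subr0 | exists 0%N, n.+1; rewrite sub0r].
have [[Ou nPu] [Ov nPv]] := (nprime_cpi_expM nb Oa nPa, nprime_cpi_expM na Ob nPb).
set u := _ * a in Ou nPu; set v := _ * b in Ov nPv.
have [u0 v0] := (nprime_neq0 prP nPu, nprime_neq0 prP nPv).
have [piu0 piv0] : pi ^+ na * u != 0 /\ pi ^+ nb * v != 0.
  by split; rewrite mulf_neq0 ?expf_neq0.
have x_frac : x = pi ^+ na * u / (pi ^+ nb * v).
  rewrite -(mulKf (expfz_neq0 m c0) x) Dx Dm expfzDr // -invr_expz -!exprnP /u /v.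
  by rewrite !exprMn; field; rewrite (nprime_neq0 prP nPb) !expf_neq0.
split; first by rewrite x_frac mulf_neq0 ?invr_eq0.
exists (pi ^+ na * u), (pi ^+ nb * v), na, nb.
have OpiM n w : O w -> O (pi ^+ n * w) by move=> Ow; apply: ringOIM => //; apply: ringOIX.
do 2!(split; first exact: OpiM); do 3!split=> //.
by split; [|split=> //]; apply: ipow_exact_pi_expM.
Qed.

Lemma ord_geP (x : algC) (m : int) : ord_ge K P x m <-> loc (c ^ m * x).
Proof.
have [c0 pi0] := andP c_pi_neq0.
split=> [[-> | [n [/ord_isP/local_unit_int loc_x le_mn]]] | [a [b [Oa Ob nPb Dx]]]].
- by rewrite mulr0; apply: local_int_ringOI => //; apply: (ringOI_nat sK 0).
- have -> : c ^ m * x = c^-1 ^+ `|n - m|%N * (c ^ n * x).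
    rewrite exprVn exprnP invr_expz mulrA -expfzDr //.
    by rewrite gez0_abs ?subr_ge0 // opprB subrK.
  apply: local_intM => //; apply: local_intX => //.
  by exists pi, (c * pi); split=> //; rewrite invfM mulrCA divff ?mulr1.
have [-> | x0] := eqVneq x 0; [by left | right].
have a0 : a != 0.
  apply: contraNneq x0 => a0; move/eqP: Dx.
  by rewrite a0 mul0r mulf_eq0 expfz_eq0 (negPf c0) andbF.
have [n [Oca nPca]] := ipow_exact_exists Oa a0.
exists (n%:Z + m); split; last by rewrite lerDr.
by apply/ord_isP; exists (c ^+ n * a), b; rewrite expfzDr // -[LHS]mulrA Dx mulrA.
Qed.

End InverseUniformizer.

Section Valuation.

Variables K P : algC -> Prop.
Hypothesis nfK : number_field K.
Hypothesis prP : prime_of K P.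
Local Notation O := (ringOI K).
Local Notation ord_is := (ord_is K P).
Local Notation ord_ge := (ord_ge K P).

Let sK : is_subfield K := proj1 nfK.

Lemma ord_is_mem (x : algC) (m : int) : ord_is x m -> K x.
Proof. by move=> [_ [a [b [_ [_ [[Ka _] [[Kb _] [_ [_ [-> _]]]]]]]]]]; apply: subfield_div. Qed.

Lemma ord_is_exists (x : algC) : K x -> x != 0 -> exists m, ord_is x m.
Proof.
have [c [pi unif]] := inverse_uniformizer_exists nfK prP.
move=> Kx x0; have [a [b [Oa Ob b0 Dx]]] := subfield_frac sK Kx.
have a0 : a != 0 by apply: contraNneq x0 => a0; rewrite Dx a0 mul0r.
have [na [Oca nPca]] := ipow_exact_exists nfK prP unif Oa a0.
have [nb [Ocb nPcb]] := ipow_exact_exists nfK prP unif Ob b0.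
exists (na%:Z - nb%:Z); apply/(ord_isP nfK prP unif).
exists (c ^+ na * a), (c ^+ nb * b); split=> //.
by rewrite expfzDr ?(inv_unif_neq0 prP unif) // -invr_expz -!exprnP Dx mulf_div.
Qed.

Lemma ord_is_uniq (x : algC) (m n : int) : ord_is x m -> ord_is x n -> m = n.
Proof.
have [c [pi unif]] := inverse_uniformizer_exists nfK prP.
have c0 := inv_unif_neq0 prP unif.
move=> ord_m; have x0 := proj1 ord_m.
move: ord_m => /(ord_isP nfK prP unif) um /(ord_isP nfK prP unif) un.
apply/eqP; rewrite -subr_eq0; apply/eqP/(local_unit_expz_inv_unif nfK prP unif).
have -> : c ^ (m - n) = c ^ m * x * (c ^ n * x)^-1.
  by rewrite expfzDr // -invr_expz; field; rewrite x0 expfz_neq0.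
exact/local_unitM/local_unitV.
Qed.

Lemma ord_isM (x y : algC) (m n : int) : ord_is x m -> ord_is y n -> ord_is (x * y) (m + n).
Proof.
have [c [pi unif]] := inverse_uniformizer_exists nfK prP.
move=> /(ord_isP nfK prP unif) ux /(ord_isP nfK prP unif) uy.
apply/(ord_isP nfK prP unif); rewrite expfzDr ?(inv_unif_neq0 prP unif) // mulrACA.
exact: local_unitM.
Qed.

Lemma ord_isV (x : algC) (m : int) : ord_is x m -> ord_is x^-1 (- m).
Proof.
have [c [pi unif]] := inverse_uniformizer_exists nfK prP.
move=> /(ord_isP nfK prP unif) ux; apply/(ord_isP nfK prP unif).
by rewrite -invr_expz -invfM; apply: local_unitV.
Qed.

Lemma ord_is0P (x : algC) : ord_is x 0 <-> local_unit K P x.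
Proof.
have [c [pi unif]] := inverse_uniformizer_exists nfK prP.
by rewrite -[x in local_unit _ _ x]mul1r; apply: (ord_isP nfK prP unif).
Qed.

Lemma ord_is_nprime (x : algC) : O x -> ~ P x -> ord_is x 0.
Proof. by move=> Ox nPx; apply/ord_is0P/local_unit_nprime. Qed.

Lemma ord_isX (x : algC) (m : int) (n : nat) : ord_is x m -> ord_is (x ^+ n) (m * n).
Proof.
move=> xm; elim: n => [|n IHn].
  by rewrite mulr0; apply: ord_is_nprime; [apply: ringOI1 | apply: nprime1 prP].
by rewrite exprS intS mulrDr mulr1; apply: ord_isM.
Qed.

Lemma ord_isN1 : ord_is (-1) 0.
Proof.
apply: ord_is_nprime; first exact/ringOIN/ringOI1.
move=> PN1; apply: (nprime1 prP); rewrite -[1]opprK -mulN1r.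
by apply: (primeMl prP) => //; apply/ringOIN/ringOI1.
Qed.

Lemma ord_is_surj (m : int) : exists x, ord_is x m.
Proof.
have [c [pi unif]] := inverse_uniformizer_exists nfK prP.
exists (c ^ (- m)); apply/(ord_isP nfK prP unif).
rewrite -expfzDr ?(inv_unif_neq0 prP unif) // subrr.
by apply: (local_unit_nprime nfK prP); [apply: ringOI1 | apply: nprime1 prP].
Qed.

Lemma ord_is_ge (x : algC) (m : int) : ord_is x m -> ord_ge x m.
Proof. by right; exists m. Qed.

Lemma ord_is_nge (x : algC) (m n : int) : ord_is x m -> m < n -> ~ ord_ge x n.
Proof.
move=> xm lt_mn [x0 | [k [xk le_nk]]]; first by case: xm; rewrite x0 eqxx.
by rewrite (ord_is_uniq xm xk) ltNge le_nk in lt_mn.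
Qed.

Lemma ord_ge_le (x : algC) (m n : int) : m <= n -> ord_ge x n -> ord_ge x m.
Proof.
move=> le_mn [-> | [k [xk le_nk]]]; first by left.
by right; exists k; split=> //; apply: le_trans le_nk.
Qed.

Lemma ord_ge_exists (x : algC) : K x -> exists m, ord_ge x m.
Proof.
move=> Kx; have [->|x0] := eqVneq x 0; first by exists 0; left.
by have [m xm] := ord_is_exists Kx x0; exists m; apply: ord_is_ge.
Qed.

Lemma ord_geM (x y : algC) (m n : int) : ord_ge x m -> ord_ge y n -> ord_ge (x * y) (m + n).
Proof.
move=> [-> | [i [xi le_mi]]]; first by left; rewrite mul0r.
move=> [-> | [j [yj le_nj]]]; first by left; rewrite mulr0.
by right; exists (i + j); split; [apply: ord_isM | apply: lerD].
Qed.

Lemma ord_geN (x : algC) (m : int) : ord_ge x m -> ord_ge (- x) m.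
Proof. by move=> xm; rewrite -mulN1r -[m]add0r; apply/ord_geM/xm/ord_is_ge/ord_isN1. Qed.

Lemma ord_geD (x y : algC) (m : int) : ord_ge x m -> ord_ge y m -> ord_ge (x + y) m.
Proof.
have [c [pi unif]] := inverse_uniformizer_exists nfK prP.
move=> /(ord_geP nfK prP unif) lx /(ord_geP nfK prP unif) ly.
by apply/(ord_geP nfK prP unif); rewrite mulrDr; apply: local_intD.
Qed.

Lemma ord_isD (x y : algC) (m n : int) :
  ord_is x m -> ord_ge y n -> m < n -> ord_is (x + y) m.
Proof.
move=> xm yn lt_mn; have nge_x := ord_is_nge xm.
have xyK : x = (x + y) - y by rewrite addrK.
have [xy0 | [k [xyk]]] : ord_ge (x + y) m.
- by apply: ord_geD (ord_is_ge xm) (ord_ge_le (ltW lt_mn) yn).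
- by case: (nge_x n lt_mn); rewrite xyK xy0 sub0r; apply: ord_geN.
rewrite le_eqVlt => /predU1P[-> // | lt_mk].
case: (nge_x (Num.min k n)); first by rewrite lt_min lt_mk.
rewrite xyK; apply: ord_geD; last apply: ord_geN.
- by apply: ord_ge_le (ord_is_ge xyk); rewrite ge_min lexx.
- by apply: ord_ge_le yn; rewrite ge_min lexx orbT.
Qed.

Lemma horner_ord_continuous (f : {poly algC}) (s : algC) (m : int) :
  poly_over K f -> K s ->
  exists n : int, forall t, ord_ge (t - s) n -> ord_ge (f.[t] - f.[s]) m.
Proof.
move=> + Ks; elim/poly_ind: f m => [|q a IHq] m Kf.
  by exists 0 => t _; left; rewrite !horner0 subrr.
have Kq : poly_over K q by move=> i; have := Kf i.+1; rewrite coefD coefMX coefC addr0.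
have [i s_i] := ord_ge_exists Ks.
have [j qs_j] := ord_ge_exists (poly_over_horner sK Kq Ks).
have [n qP] := IHq (Num.max m (m - i)) Kq.
exists (Num.max n (Num.max 0 (m - j))) => t t_s.
have t_s_ge k : k <= Num.max n (Num.max 0 (m - j)) -> ord_ge (t - s) k.
  by move=> le_k; apply: ord_ge_le t_s.
have q_ge : ord_ge (q.[t] - q.[s]) (Num.max m (m - i)) by apply/qP/t_s_ge; lia.
have -> : (q * 'X + a%:P).[t] - (q * 'X + a%:P).[s] =
    (q.[t] - q.[s]) * (t - s) + (q.[t] - q.[s]) * s + (t - s) * q.[s].
  by rewrite !hornerE; ring.
apply: ord_geD; first apply: ord_geD.
- by apply: ord_ge_le (ord_geM q_ge (t_s_ge 0 _)); lia.
- by apply: ord_ge_le (ord_geM q_ge s_i); lia.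
- by apply: ord_ge_le (ord_geM (t_s_ge (m - j) _) qs_j); lia.
Qed.

Lemma horner_ord_locally_constant (f : {poly algC}) (s : algC) (m : int) :
  poly_over K f -> K s -> ord_is f.[s] m ->
  exists n : int, forall t, ord_ge (t - s) n -> ord_is f.[t] m.
Proof.
move=> Kf Ks fs_m; have [n contf] := horner_ord_continuous (m + 1) Kf Ks.
exists n => t /contf ft; rewrite -(subrKC f.[s] f.[t]).
by apply: ord_isD fs_m ft _; rewrite ltrDl.
Qed.

End Valuation.

(** * Divisibility of the order *)

Definition ord_dvd (K P : algC -> Prop) (d : nat) (x : algC) : Prop :=
  x = 0 \/ exists m : int, ord_is K P x m /\ (d %| m)%Z.

Section OrdDivisibility.

Variables K P : algC -> Prop.
Hypothesis nfK : number_field K.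
Hypothesis prP : prime_of K P.
Variable d : nat.
Local Notation ord_is := (ord_is K P).
Local Notation ord_dvd := (ord_dvd K P d).

Lemma ord_is_dvd (x : algC) (m : int) : ord_is x m -> ord_dvd x -> (d %| m)%Z.
Proof.
move=> xm [x0 | [n [xn dvd_n]]]; first by case: xm; rewrite x0 eqxx.
by rewrite (ord_is_uniq nfK prP xm xn).
Qed.

Lemma ord_dvd_nprime (x : algC) : ringOI K x -> ~ P x -> ord_dvd x.
Proof. by move=> Ox nPx; right; exists 0; split=> //; apply: ord_is_nprime. Qed.

Lemma ord_dvdM (x y : algC) : ord_dvd x -> ord_dvd y -> ord_dvd (x * y).
Proof.
move=> [-> | [m [xm dvd_m]]]; first by left; rewrite mul0r.
move=> [-> | [n [yn dvd_n]]]; first by left; rewrite mulr0.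
by right; exists (m + n); rewrite rpredD //; split=> //; apply: ord_isM.
Qed.

Lemma ord_dvdN (x : algC) : ord_dvd x -> ord_dvd (- x).
Proof.
rewrite -mulN1r; apply: ord_dvdM; right; exists 0; split=> //.
exact: ord_isN1.
Qed.

Lemma ord_dvd_exp (x : algC) : K x -> ord_dvd (x ^+ d).
Proof.
move=> Kx; have [-> | x0] := eqVneq x 0.
  rewrite expr0n; case: eqP => _; last by left.
  exact: ord_dvd_nprime (ringOI1 (proj1 nfK)) (nprime1 prP).
have [m xm] := ord_is_exists nfK prP Kx x0.
by right; exists (m * d); rewrite dvdz_mull //; split=> //; apply: ord_isX.
Qed.

Lemma ord_dvd_sqrt (x : algC) : odd d -> K x -> ord_dvd (x ^+ 2) -> ord_dvd x.
Proof.
move=> odd_d Kx dvd_x2; have [-> | x0] := eqVneq x 0; first by left.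
have [m xm] := ord_is_exists nfK prP Kx x0; right; exists m; split=> //.
have := ord_is_dvd (ord_isX nfK prP 2 xm) dvd_x2.
by rewrite Gauss_dvdzl // coprimezE /= coprimen2.
Qed.

(* Unless ord u = ord v, the smaller of the two is ord (u + v), and ord u + ord v = ord (u v). *)
Lemma ord_dvd_sum_prod (u v : algC) :
  odd d -> K u -> K v -> ord_dvd (u + v) -> ord_dvd (u * v) -> ord_dvd u.
Proof.
move=> odd_d Ku Kv dvdD dvdM; have [-> | u0] := eqVneq u 0; first by left.
have [v0 | v0] := eqVneq v 0; first by rewrite v0 addr0 in dvdD.
have [a ua] := ord_is_exists nfK prP Ku u0; have [b vb] := ord_is_exists nfK prP Kv v0.
have dvd_ab := ord_is_dvd (ord_isM nfK prP ua vb) dvdM.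
right; exists a; split=> //; have [lt_ab | lt_ba | eq_ab] := ltgtP a b.
- exact: ord_is_dvd (ord_isD nfK prP ua (ord_is_ge vb) lt_ab) dvdD.
- rewrite addrC in dvdD; have := ord_is_dvd (ord_isD nfK prP vb (ord_is_ge ua) lt_ba) dvdD.
  by rewrite -(addrK b a) => dvd_b; rewrite rpredB.
by move: dvd_ab; rewrite -eq_ab -mulr2n -mulr_natr Gauss_dvdzl // coprimezE /= coprimen2.
Qed.

Lemma ord_dvd_power_curve (x y z : algC) :
  odd d -> ~ P 2%:R -> K x -> K y -> K z -> (y - z) * (y + z) = - x ^+ d ->
  ord_dvd (y ^+ 2) -> ord_dvd (y - z).
Proof.
have sK := proj1 nfK; move=> odd_d nP2 Kx Ky Kz curve dvd_y2.
apply: (@ord_dvd_sum_prod _ (y + z)) => //; [exact: subfieldB | exact: subfieldD | |].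
  rewrite (_ : _ + _ = 2%:R * y); last by ring.
  by apply: ord_dvdM; [apply: ord_dvd_nprime => //; apply: ringOI_nat | apply: ord_dvd_sqrt].
by rewrite curve; apply/ord_dvdN/ord_dvd_exp.
Qed.

End OrdDivisibility.

Section PrimeAbove.

Variables K P L Q : algC -> Prop.
Hypotheses (nfK : number_field K) (prP : prime_of K P).
Hypotheses (nfL : number_field L) (prQ : prime_of L Q).
Hypothesis subKL : forall z, K z -> L z.
Hypothesis QP : forall z, ringOI K z -> (Q z <-> P z).

Lemma ord_is0_above (x : algC) : ord_is K P x 0 -> ord_is L Q x 0.
Proof.
have OL z : ringOI K z -> ringOI L z by case=> Kz Az; split=> //; apply: subKL.
move=> /(ord_is0P nfK prP)[a [b [Oa Ob nPa nPb Dx]]]; apply/(ord_is0P nfL prQ).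
by exists a, b; split=> //; try exact: OL; rewrite QP.
Qed.

Lemma ord_dvd_above (d : nat) (x : algC) : ord_dvd K P d x -> ord_dvd L Q d x.
Proof.
move=> [-> | [n [xn /dvdzP[m Dn]]]]; [by left | rewrite Dn in xn].
have [z zm] := ord_is_surj nfK prP m.
have zd := ord_isX nfK prP d zm.
have Dx : x = z ^+ d * (x / z ^+ d) by rewrite mulrC divfK //; case: zd.
rewrite Dx; apply: (ord_dvdM nfL prQ).
  by apply: (ord_dvd_exp nfL prQ); apply/subKL/(ord_is_mem nfK zm).
right; exists 0; split=> //; apply: ord_is0_above.
by rewrite -(subrr (m * d)); apply: (ord_isM nfK prP) => //; apply: ord_isV.
Qed.

End PrimeAbove.

(** * Adjoining a square root *)

Lemma adjoin_sub (F : algC -> Prop) (y x : algC) : F x -> adjoin F y x.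
Proof. by move=> Fx G _ FG _; apply: FG. Qed.

Lemma adjoin_gen (F : algC -> Prop) (y : algC) : adjoin F y y.
Proof. by move=> G. Qed.

Lemma adjoin_subfield (F : algC -> Prop) (y : algC) : is_subfield (adjoin F y).
Proof.
split; first by move=> G sG _ _; apply: subfield0.
split; first by move=> G sG _ _; apply: subfield1.
split; first by move=> u v Fu Fv G sG FG Gy; apply: subfieldD => //; [apply: Fu | apply: Fv].
split; first by move=> u Fu G sG FG Gy; apply: subfieldN => //; apply: Fu.
split; first by move=> u v Fu Fv G sG FG Gy; apply: subfieldM => //; [apply: Fu | apply: Fv].
by move=> u Fu G sG FG Gy; apply: subfieldV => //; apply: Fu.
Qed.

Definition quad_span (F : algC -> Prop) (y z : algC) : Prop :=
  exists a b : algC, [/\ F a, F b & z = a + b * y].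

Section AdjoinSqrt.

Variables (F : algC -> Prop) (y : algC).
Hypothesis sF : is_subfield F.
Hypothesis Fy2 : F (y ^+ 2).

Lemma quad_span_base (x : algC) : F x -> quad_span F y x.
Proof. by move=> Fx; exists x, 0; rewrite mul0r addr0; split=> //; apply: subfield0. Qed.

Lemma quad_spanV (z : algC) : quad_span F y z -> quad_span F y z^-1.
Proof.
move=> [a [b [Fa Fb ->]]]; have [conj0 | conj0] := eqVneq (a - b * y) 0.
  have -> : a + b * y = a + a by rewrite -[b * y](subKr a) conj0 subr0.
  by apply: quad_span_base; apply: subfieldV => //; apply: subfieldD.
have [-> | z0] := eqVneq (a + b * y) 0; first by rewrite invr0; apply: quad_span_base (subfield0 sF).
pose N := a * a - b * b * y ^+ 2; have DN : N = (a + b * y) * (a - b * y) by rewrite /N; ring.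
have FN : F N by apply: subfieldB => //; do 2?[apply: subfieldM => //].
exists (a / N), (- b / N); split; [exact: (subfield_div sF) | |].
  by apply: subfield_div => //; apply: subfieldN.
by rewrite DN; field; rewrite z0 conj0.
Qed.

Lemma quad_span_subfield : is_subfield (quad_span F y).
Proof.
split; first exact: quad_span_base (subfield0 sF).
split; first exact: quad_span_base (subfield1 sF).
split.
  move=> _ _ [a [b [Fa Fb ->]]] [a' [b' [Fa' Fb' ->]]].
  by exists (a + a'), (b + b'); split; [apply: subfieldD | apply: subfieldD | ring].
split.
  move=> _ [a [b [Fa Fb ->]]].
  by exists (- a), (- b); split; [apply: subfieldN | apply: subfieldN | ring].
split; last exact: quad_spanV.
move=> _ _ [a [b [Fa Fb ->]]] [a' [b' [Fa' Fb' ->]]].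
exists (a * a' + b * b' * y ^+ 2), (a * b' + b * a'); split; last by ring.
- by apply: subfieldD => //; do 2?[apply: subfieldM => //].
- by apply: subfieldD => //; apply: subfieldM.
Qed.

Lemma adjoin_sqrt_quad_span (z : algC) : adjoin F y z -> quad_span F y z.
Proof.
move=> Lz; apply: (Lz (quad_span F y)); [exact: quad_span_subfield | exact: quad_span_base |].
by exists 0, 1; rewrite add0r mul1r; split=> //; [apply: subfield0 | apply: subfield1].
Qed.

End AdjoinSqrt.

Lemma number_field_adjoin_sqrt (F : algC -> Prop) (y : algC) :
  number_field F -> F (y ^+ 2) -> number_field (adjoin F y).
Proof.
move=> [sF [n [s spanF]]] Fy2; split; first exact: adjoin_subfield.
exists (n + n)%N, (fun i => match split i with inl j => s j | inr j => s j * y end).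
move=> _ /(adjoin_sqrt_quad_span sF Fy2)[a [b [Fa Fb ->]]].
have [[u Du] [v Dv]] := (spanF a Fa, spanF b Fb).
exists (fun i => match split i with inl j => u j | inr j => v j end).
rewrite big_split_ord /= Du Dv mulr_suml; congr (_ + _); apply: eq_bigr => i _.
  by rewrite (unsplitK (inl i)).
by rewrite (unsplitK (inr i)) mulrA.
Qed.

Lemma curve_point_factor (f aX bX cY dY : {poly algC}) (t y : algC) :
  cY ^+ 2 * bX ^+ 3 = (aX ^+ 3 + f * bX ^+ 3) * dY ^+ 2 ->
  bX.[t] != 0 -> dY.[t] != 0 -> y ^+ 2 = f.[t] ->
  (y - cY.[t] / dY.[t]) * (y + cY.[t] / dY.[t]) = - (aX.[t] / bX.[t]) ^+ 3.
Proof.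
move=> /(congr1 (horner^~ t)) /=; rewrite !(hornerM, hornerD, horner_exp).
move=> curve_t bt dt y2; rewrite -subr_sqr y2.
transitivity (f.[t] - (cY.[t] ^+ 2 * bX.[t] ^+ 3) / (bX.[t] ^+ 3 * dY.[t] ^+ 2)).
  by field; rewrite bt dt.
by rewrite curve_t; field; rewrite bt dt.
Qed.

Unset Implicit Arguments.

(* X0 = aX / bX and Y0 = cY / dY in reduced form, as elements of k(t). *)
Theorem theorem3p2 (k : algC -> Prop) (f aX bX cY dY : {poly algC})
  (P : algC -> Prop) (tp : algC) :
  number_field k ->
  poly_over k f -> (1 < size f)%N ->
  poly_over k aX -> poly_over k bX -> poly_over k cY -> poly_over k dY ->
  bX != 0 -> dY != 0 -> coprimep aX bX -> coprimep cY dY ->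
  cY ^+ 2 * bX ^+ 3 = (aX ^+ 3 + f * bX ^+ 3) * dY ^+ 2 ->
  prime_of k P -> ~ P 2%:R ->
  k tp -> f.[tp] != 0 ->
  (exists m : int, ord_is k P f.[tp] m /\ (3 %| m)%Z) ->
  exists N : int,
    forall t : algC, k t ->
      (t = tp \/ exists m : int, ord_is k P (t - tp) m /\ N <= m) ->
      bX.[t] != 0 -> dY.[t] != 0 ->
      forall y : algC, y ^+ 2 = f.[t] -> y != cY.[t] / dY.[t] ->
      forall Q : algC -> Prop,
        prime_of (adjoin k y) Q ->
        (forall x, ringOI k x -> (Q x <-> P x)) ->
        exists m : int, ord_is (adjoin k y) Q (y - cY.[t] / dY.[t]) m /\ (3 %| m)%Z.
Proof.
move=> nfk kf _ kaX kbX kcY kdY _ _ _ _ curve prP nP2 ktp _ [m [ord_ftp dvd3m]].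
have [N const_f] := horner_ord_locally_constant nfk prP kf ktp ord_ftp.
exists N => t kt near bt dt y y2 yY Q prQ QP; have sk := proj1 nfk.
have ord_ft : ord_is k P f.[t] m.
  by apply: const_f; case: near => [->|]; [left; rewrite subrr | right].
have nfL : number_field (adjoin k y).
  by apply: number_field_adjoin_sqrt => //; rewrite y2; apply: poly_over_horner.
have Lfrac p q : poly_over k p -> poly_over k q -> adjoin k y (p.[t] / q.[t]).
  by move=> kp kq; apply: adjoin_sub; apply: subfield_div => //; apply: poly_over_horner.
have nQ2 : ~ Q 2%:R by rewrite QP //; apply: ringOI_nat.
have dvd3_y2 : ord_dvd (adjoin k y) Q 3 (y ^+ 2).
  by rewrite y2; apply: (ord_dvd_above nfk prP nfL prQ (@adjoin_sub k y) QP); right; exists m.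
have [Lx Lz] := (Lfrac _ _ kaX kbX, Lfrac _ _ kcY kdY); have Ly := @adjoin_gen k y.
have factor := curve_point_factor curve bt dt y2.
have [/eqP | //] := ord_dvd_power_curve nfL prQ (d := 3) isT nQ2 Lx Ly Lz factor dvd3_y2.
by rewrite subr_eq0 (negPf yY).
Qed.
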